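(* For every $x\in\mathbb{C}\setminus(\mathbb{Z}\setminus\{0\})$, \[ {}_3F_2\left({1,1,3/2\atop 2-x,2+x};1\right)=4\log(2)(1-x^2)+2(1-x^2)\big(\psi(1-x/2)+\psi(1+x/2)\big)-2(1-x^2)\big(\psi(1-x)+\psi(1+x)\big). \]
   Context: For $x\in\mathbb{C}$ and integer $n\ge0$, $(x)_n:=x(x+1)\cdots(x+n-1)$ with $(x)_0:=1$. The generalized hypergeometric series is \[ {}_pF_q\left({a_1,\ldots,a_p\atop b_1,\ldots,b_q};z\right):=\sum_{n=0}^\infty \frac{(a_1)_n\cdots(a_p)_n}{(b_1)_n\cdots(b_q)_n}\frac{z^n}{n!}. \] $\psi$ denotes the digamma function, $\psi(s)=-\gamma-\frac1s+\sum_{k=1}^\infty\left(\frac1k-\frac1{s+k}\right)$ for $s\in\mathbb{C}\setminus\{0,-1,-2,\ldots\}$, where $\gamma$ is the Euler–Mascheroni constant. *)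

(* Defs.v *)
From Stdlib Require Import Reals Factorial List.
From Coquelicot Require Export Coquelicot.
Import ListNotations.

Open Scope C_scope.

(* Coquelicot's [Series] is real-valued. As with [Series], the value is
   meaningful only when the series converges. *)
Definition CSeries (a : nat -> C) : C :=
  (Series (fun n => Re (a n)), Series (fun n => Im (a n))).

Fixpoint pochhammer (x : C) (n : nat) : C :=
  match n with
  | O => 1
  | S m => pochhammer x m * (x + INR m)
  end.

Definition pochhammer_prod (l : list C) (n : nat) : C :=
  fold_right Cmult 1 (map (fun a => pochhammer a n) l).

Definition hypergeom_term (a b : list C) (z : C) (n : nat) : C :=
  pochhammer_prod a n / pochhammer_prod b n * (z ^ n / INR (fact n)).

(* The series pFq(a; b; z), with p = length a and q = length b, converges
   and its sum is [l]. *)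
Definition is_hypergeom (a b : list C) (z l : C) : Prop :=
  is_series (K := C_AbsRing) (V := C_NormedModule) (hypergeom_term a b z) l.

(* Index shift: the n-th term is 1 + 1/2 + ... + 1/(n+1) - ln (n+1). *)
Definition Euler_gamma : R :=
  real (Lim_seq (fun n =>
    sum_f_R0 (fun k => / INR (S k)) n - ln (INR (S n)))%R).

(* The sum over k >= 1 is indexed by k = S n. *)
Definition digamma (s : C) : C :=
  - Euler_gamma - 1 / s +
  CSeries (fun n => 1 / INR (S n) - 1 / (s + INR (S n))).

(* Main.v *)
(** Write [B_n] for the n-th partial sum of the alternating series
    [sum_(k >= 1) (-1)^(k-1) 4k / (k^2 - x^2)]. Expanding
    [1 / prod_(k <= m) (k^2 - x^2)] in partial fractions and summing by parts,
    the N-th partial sum of the hypergeometric series, divided by [1 - x^2], is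
    exactly the weighted mean [sum_(j <= N) lambda(N,j) B_j] with
    [lambda(N,j) = N! (3/2)_N / ((N-j)! (N+1+j)!)]. The weights are nonnegative,
    have total mass 1, and [lambda(N,j) <= lambda(N,0) -> 0], so by the
    Silverman-Toeplitz argument the means converge to [lim B_n]. Splitting
    [B_2n] into harmonic-type sums identifies this limit with the digamma
    expression; [ln 2] enters as the limit of [H_(2n+1) - H_n]. *)
Require Import Defs.
From Stdlib Require Import Reals Factorial List Lra Lia.
From Coquelicot Require Import Coquelicot.
Import ListNotations.
Open Scope C_scope.

(** * Reciprocals of [(N-j)! (N+j)!] and their recurrences *)

(* The convention [0] for [j > N] makes both recurrences in [N] and [j] below
   hold without side condition. *)
Definition inv_fact2 (N j : nat) : R :=
  if (j <=? N)%nat then / (INR (fact (N - j)) * INR (fact (N + j))) else 0.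

Lemma inv_fact2_gt (N j : nat) : (N < j)%nat -> inv_fact2 N j = 0%R.
Proof.
  intros H; unfold inv_fact2.
  now rewrite (proj2 (Nat.leb_gt j N) H).
Qed.

Lemma inv_fact2_ge0 (N j : nat) : (0 <= inv_fact2 N j)%R.
Proof.
  unfold inv_fact2; destruct (j <=? N)%nat; [ | lra].
  apply Rlt_le, Rinv_0_lt_compat, Rmult_lt_0_compat; apply INR_fact_lt_0.
Qed.

Lemma inv_fact2_succ_r (N j : nat) :
  (inv_fact2 N (S j) * (INR N + INR j + 1) = inv_fact2 N j * (INR N - INR j))%R.
Proof.
  destruct (Nat.lt_trichotomy j N) as [H | [-> | H]].
  - unfold inv_fact2.
    rewrite (proj2 (Nat.leb_le (S j) N)), (proj2 (Nat.leb_le j N)) by lia.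
    replace (N - j)%nat with (S (N - S j)) by lia.
    replace (N + S j)%nat with (S (N + j)) by lia.
    rewrite !fact_simpl, !mult_INR, !S_INR, plus_INR.
    rewrite (minus_INR N (S j)) by lia; rewrite S_INR.
    assert (Hlt : (INR j + 1 <= INR N)%R) by (rewrite <- S_INR; apply le_INR; lia).
    pose proof (pos_INR j); pose proof (pos_INR N).
    field; repeat split; try apply INR_fact_neq_0; lra.
  - rewrite inv_fact2_gt by lia; ring.
  - rewrite !inv_fact2_gt by lia; ring.
Qed.

Lemma inv_fact2_succ_l (N j : nat) :
  (inv_fact2 (S N) j * ((INR N + 1) ^ 2 - INR j ^ 2) = inv_fact2 N j)%R.
Proof.
  destruct (Nat.lt_trichotomy j (S N)) as [H | [-> | H]].
  - unfold inv_fact2.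
    rewrite (proj2 (Nat.leb_le j (S N))), (proj2 (Nat.leb_le j N)) by lia.
    replace (S N - j)%nat with (S (N - j)) by lia.
    replace (S N + j)%nat with (S (N + j)) by lia.
    rewrite !fact_simpl, !mult_INR, !S_INR, plus_INR.
    rewrite (minus_INR N j) by lia.
    assert (Hlt : (INR j <= INR N)%R) by (apply le_INR; lia).
    pose proof (pos_INR j); pose proof (pos_INR N).
    field; repeat split; try apply INR_fact_neq_0; lra.
  - rewrite (inv_fact2_gt N) by lia; rewrite S_INR; ring.
  - rewrite !inv_fact2_gt by lia; ring.
Qed.

(** * Finite complex sums and summation by parts *)

Definition Csum (f : nat -> C) (n : nat) : C := sum_n f n.

Lemma Csum_O (f : nat -> C) : Csum f 0 = f O.
Proof. exact (sum_O f). Qed.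

Lemma Csum_S (f : nat -> C) (n : nat) : Csum f (S n) = Csum f n + f (S n).
Proof. exact (sum_Sn f n). Qed.

Lemma Csum_ext (f g : nat -> C) (n : nat) :
  (forall k, f k = g k) -> Csum f n = Csum g n.
Proof. exact (sum_n_ext f g n). Qed.

Lemma Csum_scal_l (a : C) (f : nat -> C) (n : nat) :
  Csum (fun k => a * f k) n = a * Csum f n.
Proof. exact (sum_n_mult_l (K := C_Ring) a f n). Qed.

Lemma Csum_minus (f g : nat -> C) (n : nat) :
  Csum (fun k => f k - g k) n = Csum f n - Csum g n.
Proof.
  induction n as [ | n IH]; [now rewrite !Csum_O | ].
  rewrite !Csum_S, IH; ring.
Qed.

Lemma Csum_abel (u B : nat -> C) (n : nat) :
  Csum (fun j => (u j - u (S j)) * B j) n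
  = u O * B O + Csum (fun j => u (S j) * (B (S j) - B j)) n - u (S n) * B (S n).
Proof.
  induction n as [ | n IH]; [rewrite !Csum_O; ring | ].
  rewrite !Csum_S, IH; ring.
Qed.

Lemma RtoC_neq_0 (r : R) : r <> 0%R -> RtoC r <> 0.
Proof. intros H E; apply H; now injection E. Qed.

Lemma RtoC_INR_S (n : nat) : RtoC (INR (S n)) = INR n + 1.
Proof. now rewrite S_INR, RtoC_plus. Qed.

Lemma C_inv_fact2_succ_r (N j : nat) :
  inv_fact2 N (S j) * (INR N + INR j + 1) = inv_fact2 N j * (INR N - INR j).
Proof.
  rewrite <- !RtoC_plus, <- RtoC_minus, <- !RtoC_mult.
  now rewrite inv_fact2_succ_r.
Qed.

Lemma C_inv_fact2_succ_l (N j : nat) :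
  inv_fact2 (S N) j * ((INR N + 1) ^ 2 - INR j ^ 2) = inv_fact2 N j.
Proof.
  rewrite <- !RtoC_plus, <- !RtoC_pow, <- RtoC_minus, <- !RtoC_mult.
  now rewrite inv_fact2_succ_l.
Qed.

(** * Partial fractions of the reciprocal of [prod_(k <= M) (k^2 - x^2)] *)

(* Half the coefficient of [1 / (k^2 - x^2)], [k = j + 1], in the partial
   fraction expansion of [1 / prod_(k <= M) (k^2 - x^2)]. *)
Definition pf_coef (M j : nat) : C := RtoC (-1) ^ j * (INR j + 1) ^ 2 * inv_fact2 M (S j).

(* Closed form found by Gosper summation; it vanishes at [K = M]. *)
Lemma pf_coef_partial_sum (M K : nat) :
  2 * INR M * Csum (pf_coef (S M)) K
  = RtoC (-1) ^ K * (INR K + 1) * (INR K + 2) * (INR M - INR K) * inv_fact2 (S M) (S K).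
Proof.
  induction K as [ | K IH].
  - rewrite Csum_O; unfold pf_coef; simpl INR; simpl Cpow; ring.
  - rewrite Csum_S, Cmult_plus_distr_l, IH; clear IH; unfold pf_coef.
    pose proof (C_inv_fact2_succ_r (S M) (S K)) as H.
    rewrite !RtoC_INR_S in *; simpl Cpow.
    (* The factor [M - K] of the closed form at [K] is the right-hand factor of the recurrence in
       [j] at [(M+1, K+1)], so everything can be expressed through [inv_fact2 (S M) (S (S K))]. *)
    transitivity (RtoC (-1) ^ K * (INR K + 1) * (INR K + 2) *
       (inv_fact2 (S M) (S (S K)) * (INR M + 1 + (INR K + 1) + 1))
       - 2 * INR M * RtoC (-1) ^ K * (INR K + 2) ^ 2 * inv_fact2 (S M) (S (S K))).
    + rewrite H; ring.
    + ring.
Qed.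

(** With at least two factors, [1 / prod (k^2 - x^2)] decays faster than [1 / x^2] at infinity, so
    the coefficients of its partial fractions must cancel. Here this is read off from the closed
    form at [K = M]. *)
Lemma sum_pf_coef (M : nat) : (0 < M)%nat -> Csum (pf_coef (S M)) M = 0.
Proof.
  intros HM.
  assert (H : 2 * INR M <> 0).
  { rewrite <- RtoC_mult; apply RtoC_neq_0.
    pose proof (lt_0_INR M HM); lra. }
  rewrite <- (Cmult_1_l (Csum _ _)), <- (Cinv_l _ H), <- Cmult_assoc.
  rewrite pf_coef_partial_sum; ring.
Qed.

Fixpoint sq_prod (x : C) (m : nat) : C :=
  match m with
  | O => 1
  | S k => sq_prod x k * ((INR k + 1) ^ 2 - x ^ 2)
  end.

Definition not_nonzero_int (x : C) : Prop := forall k : Z, k <> 0%Z -> x <> RtoC (IZR k).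

Lemma not_nonzero_int_add (x : C) (k : nat) : not_nonzero_int x -> INR k + 1 + x <> 0.
Proof.
  intros hx E; apply (hx (- Z.of_nat (S k))%Z); [lia | ].
  rewrite opp_IZR, <- INR_IZR_INZ, RtoC_opp, RtoC_INR_S.
  replace x with (INR k + 1 + x - (INR k + 1)) by ring.
  rewrite E; ring.
Qed.

Lemma not_nonzero_int_opp (x : C) : not_nonzero_int x -> not_nonzero_int (- x).
Proof.
  intros hx k Hk E; apply (hx (- k)%Z); [lia | ].
  rewrite opp_IZR, RtoC_opp, <- E; ring.
Qed.

Lemma not_nonzero_int_sub (x : C) (k : nat) : not_nonzero_int x -> INR k + 1 - x <> 0.
Proof. intros hx; exact (not_nonzero_int_add (- x) k (not_nonzero_int_opp x hx)). Qed.

Lemma not_nonzero_int_sq (x : C) (k : nat) : not_nonzero_int x -> (INR k + 1) ^ 2 - x ^ 2 <> 0.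
Proof.
  intros hx.
  replace ((INR k + 1) ^ 2 - x ^ 2) with ((INR k + 1 + x) * (INR k + 1 - x)) by ring.
  apply Cmult_neq_0; [now apply not_nonzero_int_add | now apply not_nonzero_int_sub].
Qed.

Lemma sq_prod_neq_0 (x : C) (m : nat) : not_nonzero_int x -> sq_prod x m <> 0.
Proof.
  intros hx; induction m as [ | m IH]; simpl.
  - apply RtoC_neq_0; lra.
  - apply Cmult_neq_0; [exact IH | now apply not_nonzero_int_sq].
Qed.

(** Induction on the number of factors. Multiplying [1 / ((j+1)^2 - x^2)] by [1 / P] splits it into
    a difference of two simple fractions over a constant free of [x]. That constant is absorbed by
    the recurrence of [inv_fact2] in [N], and the leftover multiples of [1 / P] vanish by
    [sum_pf_coef]. *)
Lemma partial_fractions (x : C) (M : nat) : not_nonzero_int x ->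
  / sq_prod x (S M)
  = Csum (fun j => 2 * pf_coef (S M) j / ((INR j + 1) ^ 2 - x ^ 2)) M.
Proof.
  intros hx; induction M as [ | M IH].
  - rewrite Csum_O; pose proof (not_nonzero_int_sq x 0 hx) as H.
    assert (D1 : inv_fact2 1 1 = (/ 2)%R) by (unfold inv_fact2; simpl; field).
    unfold pf_coef; rewrite D1, RtoC_inv by lra; simpl in *.
    field; contradict H; eapply eq_trans; [ | exact H]; ring.
  - set (P := (INR (S M) + 1) ^ 2 - x ^ 2).
    assert (HP : P <> 0) by (apply not_nonzero_int_sq, hx).
    change (sq_prod x (S (S M))) with (sq_prod x (S M) * P).
    replace (/ (sq_prod x (S M) * P)) with (/ sq_prod x (S M) * / P)
      by (field; split; [exact HP | now apply sq_prod_neq_0]).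
    rewrite IH; clear IH.
    assert (E : forall j, (2 * pf_coef (S M) j / ((INR j + 1) ^ 2 - x ^ 2)) * / P
      = 2 * pf_coef (S (S M)) j / ((INR j + 1) ^ 2 - x ^ 2)
        - 2 * / P * pf_coef (S (S M)) j).
    { intros j; pose proof (not_nonzero_int_sq x j hx) as Hj.
      unfold pf_coef; rewrite <- (C_inv_fact2_succ_l (S M) (S j)).
      unfold P in *; rewrite !RtoC_INR_S in *.
      field; split; assumption. }
    transitivity (Csum (fun j => 2 * pf_coef (S (S M)) j / ((INR j + 1) ^ 2 - x ^ 2)
        - 2 * / P * pf_coef (S (S M)) j) (S M)).
    + rewrite <- (Csum_ext _ _ _ E), Csum_S.
      (* The old expansion is extended by one zero term, so that both sums run up to [S M]. *)
      assert (Z : pf_coef (S M) (S M) = 0)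
        by (unfold pf_coef; rewrite inv_fact2_gt by lia; ring).
      rewrite Z; clear Z.
      rewrite Cmult_comm, <- Csum_scal_l.
      match goal with |- ?a = ?b + ?c => replace c with (RtoC 0) end.
      2: { unfold Cdiv; ring. }
      rewrite Cplus_0_r; apply Csum_ext; intros j; apply Cmult_comm.
    + rewrite Csum_minus, Csum_scal_l, sum_pf_coef by lia; ring.
Qed.

(** * The averaging weights and how they change with [N] *)

Fixpoint poch32 (n : nat) : R :=
  match n with
  | O => 1
  | S m => poch32 m * (INR m + 3 / 2)
  end.

(** This is [lambda(N,j)]: the divisor [N + j + 1] turns [(N+j)!] into [(N+1+j)!]. *)
Definition weight (N j : nat) : R :=
  (INR (fact N) * poch32 N * inv_fact2 N j / (INR N + INR j + 1))%R.

(** Vanishes at [j = 0] and at [j = N + 2], so summation by parts leaves no boundary terms. At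
    [j + 1], its product with the increment of [alt_sum] is [N! (3/2)_N] times a term of the partial
    fraction expansion. *)
Definition weight_step (N j : nat) : R :=
  (INR (fact N) * poch32 N * (INR j / 2) * inv_fact2 (S N) j)%R.

(* Zeilberger-type certificate: the increment in [N] is a difference in [j]. *)
Lemma weight_succ (N j : nat) :
  (weight (S N) j - weight N j = weight_step N j - weight_step N (S j))%R.
Proof.
  unfold weight, weight_step.
  pose proof (inv_fact2_succ_r (S N) j) as HA.
  rewrite <- (inv_fact2_succ_l N j).
  pose proof (pos_INR j); pose proof (pos_INR N).
  rewrite !S_INR in *.
  replace (inv_fact2 (S N) (S j))
    with (inv_fact2 (S N) j * (INR N + 1 - INR j) / (INR N + 1 + INR j + 1))%R
    by (rewrite <- HA; field; lra).
  rewrite fact_simpl, mult_INR, S_INR; simpl poch32.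
  field; lra.
Qed.

Lemma poch32_pos (n : nat) : (0 < poch32 n)%R.
Proof.
  induction n as [ | n IH]; simpl; [lra | ].
  pose proof (pos_INR n); apply Rmult_lt_0_compat; lra.
Qed.

Lemma weight_ge0 (N j : nat) : (0 <= weight N j)%R.
Proof.
  unfold weight; pose proof (pos_INR j); pose proof (pos_INR N).
  apply Rmult_le_pos; [ | apply Rlt_le, Rinv_0_lt_compat; lra].
  repeat apply Rmult_le_pos.
  - apply pos_INR.
  - apply Rlt_le, poch32_pos.
  - apply inv_fact2_ge0.
Qed.

Lemma weight_gt (N j : nat) : (N < j)%nat -> weight N j = 0%R.
Proof. intros H; unfold weight; rewrite inv_fact2_gt by assumption; unfold Rdiv; ring. Qed.

(** Summation by parts moves the difference in [j] supplied by [weight_succ] onto [B]. This makes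
    the increment of the means computable term by term. *)
Lemma weighted_sum_succ (B : nat -> C) (N : nat) :
  Csum (fun j => weight (S N) j * B j) (S N)
  = Csum (fun j => weight N j * B j) N
    + Csum (fun j => weight_step N (S j) * (B (S j) - B j)) N.
Proof.
  assert (E : Csum (fun j => weight (S N) j * B j - weight N j * B j) (S N)
    = Csum (fun j => (RtoC (weight_step N j) - weight_step N (S j)) * B j) (S N)).
  { apply Csum_ext; intros j; rewrite <- RtoC_minus, <- weight_succ, RtoC_minus; ring. }
  rewrite Csum_minus, (Csum_abel (fun j => RtoC (weight_step N j))) in E.
  rewrite (Csum_S (fun j => weight N j * B j)), (Csum_S (fun j => weight_step N (S j) * _)) in E.
  rewrite (weight_gt N (S N)) in E by lia.
  replace (weight_step N (S (S N))) with 0%R in E.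
  2: { unfold weight_step; rewrite (inv_fact2_gt (S N)) by lia; ring. }
  replace (weight_step N 0) with 0%R in E by (unfold weight_step; simpl; lra).
  match type of E with ?a - ?b = ?c => replace a with (c + b) by (rewrite <- E; ring) end.
  ring.
Qed.

(** For the constant sequence [1] the increments in [weighted_sum_succ] vanish, so the total mass
    keeps its value at [N = 0]. *)
Lemma sum_weight (N : nat) : Csum (fun j => RtoC (weight N j)) N = 1.
Proof.
  induction N as [ | N IH].
  - rewrite Csum_O; unfold weight, inv_fact2; simpl; f_equal; field.
  - pose proof (weighted_sum_succ (fun _ => RtoC 1) N) as H.
    rewrite (Csum_ext _ (fun j => RtoC (weight (S N) j))) in H by (intros; ring).
    rewrite (Csum_ext (fun j => weight N j * 1) (fun j => RtoC (weight N j))) in H by (intros; ring).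
    rewrite (Csum_ext (fun j => weight_step N (S j) * (1 - 1)) (fun j => RtoC 0 * 0)) in H by (intros; ring).
    rewrite Csum_scal_l, IH in H; rewrite H; ring.
Qed.

(** * Hypergeometric partial sums as means of an alternating series *)

Fixpoint alt_sum (x : C) (n : nat) : C :=
  match n with
  | O => 0
  | S k => alt_sum x k + RtoC (-1) ^ k * (4 * (INR k + 1)) / ((INR k + 1) ^ 2 - x ^ 2)
  end.

(** By partial fractions, each summand on the left is exactly the increment of the mean from [n] to
    [n + 1]. The sums telescope from the mean at [0], which is zero because [alt_sum x 0 = 0]; hence
    the index [S N] on the right. *)
Lemma partial_sum_as_mean (x : C) (N : nat) : not_nonzero_int x ->
  Csum (fun n => INR (fact n) * poch32 n / sq_prod x (S n)) N
  = Csum (fun j => weight (S N) j * alt_sum x j) (S N).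
Proof.
  intros hx.
  assert (H : forall n, INR (fact n) * poch32 n / sq_prod x (S n)
     = Csum (fun j => weight_step n (S j) * (alt_sum x (S j) - alt_sum x j)) n).
  { intros n; unfold Cdiv; rewrite partial_fractions, <- Csum_scal_l by exact hx.
    apply Csum_ext; intros j; simpl alt_sum; unfold weight_step, pf_coef.
    pose proof (not_nonzero_int_sq x j hx).
    rewrite !RtoC_mult, RtoC_div, RtoC_INR_S by lra.
    field; cbv beta; contradict H; eapply eq_trans; [ | exact H]; ring. }
  induction N as [ | N IH]; rewrite weighted_sum_succ, <- H.
  - rewrite !Csum_O; simpl alt_sum; ring.
  - now rewrite Csum_S, IH.
Qed.

Lemma pochhammer_1 (n : nat) : pochhammer 1 n = INR (fact n).
Proof.
  induction n as [ | n IH]; [reflexivity | ].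
  simpl pochhammer; rewrite IH, fact_simpl, mult_INR, RtoC_mult, RtoC_INR_S; ring.
Qed.

Lemma pochhammer_3_2 (n : nat) : pochhammer (3 / 2) n = poch32 n.
Proof.
  induction n as [ | n IH]; [reflexivity | ].
  simpl; rewrite IH, RtoC_mult, RtoC_plus, RtoC_div by lra; ring.
Qed.

(** The factor [k = 1] gives [1 - x^2]; the others split as [(k - x)(k + x)]. *)
Lemma sq_prod_pochhammer (x : C) (n : nat) :
  sq_prod x (S n) = (1 - x ^ 2) * (pochhammer (2 - x) n * pochhammer (2 + x) n).
Proof.
  induction n as [ | n IH]; [simpl; ring | ].
  change (sq_prod x (S (S n))) with (sq_prod x (S n) * ((INR (S n) + 1) ^ 2 - x ^ 2)).
  rewrite IH, RtoC_INR_S; simpl pochhammer; ring.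
Qed.

Lemma hypergeom_term_eq (x : C) (n : nat) : not_nonzero_int x ->
  hypergeom_term [RtoC 1; RtoC 1; 3 / 2] [2 - x; 2 + x] 1 n
  = (1 - x ^ 2) * (INR (fact n) * poch32 n / sq_prod x (S n)).
Proof.
  intros hx; pose proof (sq_prod_neq_0 x (S n) hx) as H.
  unfold hypergeom_term, pochhammer_prod; simpl map; simpl fold_right.
  rewrite pochhammer_1, pochhammer_3_2, Cpow_1_l.
  rewrite sq_prod_pochhammer in *.
  assert (H1 : 1 - x ^ 2 <> 0) by (intros E; apply H; rewrite E; ring).
  assert (H2 : pochhammer (2 - x) n <> 0) by (intros E; apply H; rewrite E; ring).
  assert (H3 : pochhammer (2 + x) n <> 0) by (intros E; apply H; rewrite E; ring).
  assert (H4 : RtoC (INR (fact n)) <> 0) by (apply RtoC_neq_0, INR_fact_neq_0).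
  field; repeat split; assumption.
Qed.

(** * Convergence of complex sequences *)

(** Phrased through the modulus so that squeeze and limit rules for real sequences apply. *)
Definition Ccvg (u : nat -> C) (l : C) : Prop :=
  is_lim_seq (fun n => Cmod (u n - l)) 0%R.

Lemma Ccvg_le (u : nat -> C) (l : C) (v : nat -> R) :
  (forall n, (Cmod (u n - l) <= v n)%R) -> is_lim_seq v 0%R -> Ccvg u l.
Proof.
  intros H Hv; apply (is_lim_seq_le_le (fun _ => 0%R) _ v); [ | apply is_lim_seq_const | exact Hv].
  intros n; split; [apply Cmod_ge_0 | apply H].
Qed.

Lemma Ccvg_ext (u v : nat -> C) (l : C) :
  (forall n, u n = v n) -> Ccvg u l -> Ccvg v l.
Proof. intros H; apply is_lim_seq_ext; intros n; now rewrite H. Qed.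

Lemma Ccvg_const (l : C) : Ccvg (fun _ => l) l.
Proof.
  apply (is_lim_seq_ext (fun _ => 0%R)); [ | apply is_lim_seq_const].
  intros _; replace (l - l) with (RtoC 0) by ring; now rewrite Cmod_0.
Qed.

Lemma Ccvg_plus (u v : nat -> C) (l m : C) :
  Ccvg u l -> Ccvg v m -> Ccvg (fun n => u n + v n) (l + m).
Proof.
  intros Hu Hv; apply (Ccvg_le _ _ (fun n => Cmod (u n - l) + Cmod (v n - m))%R).
  - intros n; replace (u n + v n - (l + m)) with ((u n - l) + (v n - m)) by ring.
    apply Cmod_triangle.
  - replace (Finite 0) with (Finite (0 + 0)) by (f_equal; ring).
    now apply is_lim_seq_plus'.
Qed.

Lemma Ccvg_scal (c : C) (u : nat -> C) (l : C) :
  Ccvg u l -> Ccvg (fun n => c * u n) (c * l).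
Proof.
  intros Hu; apply (Ccvg_le _ _ (fun n => Cmod c * Cmod (u n - l))%R).
  - intros n; replace (c * u n - c * l) with (c * (u n - l)) by ring.
    rewrite Cmod_mult; lra.
  - replace (Finite 0) with (Rbar_mult (Cmod c) 0%R) by (simpl; f_equal; ring).
    now apply is_lim_seq_scal_l.
Qed.

Lemma Ccvg_minus (u v : nat -> C) (l m : C) :
  Ccvg u l -> Ccvg v m -> Ccvg (fun n => u n - v n) (l - m).
Proof.
  intros Hu Hv.
  replace (l - m) with (l + RtoC (-1) * m) by ring.
  apply (Ccvg_ext (fun n => u n + RtoC (-1) * v n)); [intros n; ring | ].
  apply Ccvg_plus; [exact Hu | now apply Ccvg_scal].
Qed.

Lemma is_lim_seq_Rabs_minus (u : nat -> R) (l : R) :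
  is_lim_seq u l -> is_lim_seq (fun n => Rabs (u n - l)) 0%R.
Proof.
  intros Hu; replace (Finite 0) with (Rbar_abs (l - l)%R)
    by (simpl; f_equal; rewrite Rminus_diag; apply Rabs_R0).
  apply is_lim_seq_abs, is_lim_seq_minus'; [exact Hu | apply is_lim_seq_const].
Qed.

Lemma Ccvg_RtoC (u : nat -> R) (l : R) :
  is_lim_seq u l -> Ccvg (fun n => RtoC (u n)) l.
Proof.
  intros Hu; apply (Ccvg_le _ _ (fun n => Rabs (u n - l))).
  - intros n; rewrite <- RtoC_minus, Cmod_R; lra.
  - now apply is_lim_seq_Rabs_minus.
Qed.

Lemma Ccvg_of_eventually (u : nat -> C) (l : C) :
  Ccvg u l <-> forall eps : posreal, exists N, forall n, (N <= n)%nat -> (Cmod (u n - l) < eps)%R.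
Proof.
  unfold Ccvg; rewrite <- is_lim_seq_spec; simpl.
  split; intros H eps; destruct (H eps) as [N HN]; exists N; intros n Hn;
    specialize (HN n Hn); rewrite Rminus_0_r, Rabs_pos_eq in *; auto using Cmod_ge_0.
Qed.

Lemma is_series_Ccvg (a : nat -> C) (l : C) :
  Ccvg (Csum a) l -> is_series (K := C_AbsRing) (V := C_NormedModule) a l.
Proof.
  rewrite Ccvg_of_eventually; intros H.
  apply (filterlim_locally_ball_norm (K := C_AbsRing) (U := C_NormedModule)); exact H.
Qed.

Lemma Cmod_Csum_le (f : nat -> C) (n : nat) :
  (Cmod (Csum f n) <= sum_f_R0 (fun k => Cmod (f k)) n)%R.
Proof.
  induction n as [ | n IH]; [rewrite Csum_O; simpl; lra | ].
  rewrite Csum_S; simpl; eapply Rle_trans; [apply Cmod_triangle | lra].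
Qed.

Lemma Csum_RtoC (f : nat -> R) (n : nat) :
  Csum (fun k => RtoC (f k)) n = RtoC (sum_f_R0 f n).
Proof.
  induction n as [ | n IH]; [now rewrite Csum_O | ].
  now rewrite Csum_S, IH; simpl; rewrite RtoC_plus.
Qed.

(** * The Silverman-Toeplitz argument *)

(** The partial sums are nondecreasing and constant from index [J] on. The bound is uniform in [n],
    as needed for the head of the weighted mean. *)
Lemma sum_truncated_bounded (e : nat -> R) (J : nat) : (forall j, (0 <= e j)%R) ->
  exists E, forall n, (sum_f_R0 (fun j => if (j <? J)%nat then e j else 0) n <= E)%R.
Proof.
  intros He; set (f := fun j => if (j <? J)%nat then e j else 0%R).
  exists (sum_f_R0 f J); intros n.
  assert (Hmono : forall k, (sum_f_R0 f n <= sum_f_R0 f (k + n))%R).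
  { induction k as [ | k IH]; [simpl; lra | ].
    simpl; unfold f at 3; pose proof (He (S (k + n))).
    destruct (_ <? _)%nat; lra. }
  assert (Hcst : forall k, sum_f_R0 f (k + J) = sum_f_R0 f J).
  { induction k as [ | k IH]; [reflexivity | ].
    simpl; rewrite IH; unfold f at 2.
    rewrite (proj2 (Nat.ltb_ge _ _)) by lia; ring. }
  rewrite <- (Hcst n), Nat.add_comm; apply Hmono.
Qed.

(** The error is a mean of the errors [B j - l]. Those with [j < J] contribute at most [m N * E],
    which tends to 0; the others are below [eps / 2] and carry total weight at most 1. *)
Lemma Ccvg_regular_mean (w : nat -> nat -> R) (m : nat -> R) (B : nat -> C) (l : C) :
  (forall N j, (0 <= w N j <= m N)%R) ->
  (forall N, Csum (fun j => RtoC (w N j)) N = 1) ->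
  is_lim_seq m 0%R -> Ccvg B l ->
  Ccvg (fun N => Csum (fun j => w N j * B j) N) l.
Proof.
  intros Hw Hsum Hm HB; apply Ccvg_of_eventually; intros eps.
  assert (Heps : (0 < eps / 2)%R) by (pose proof (cond_pos eps); lra).
  destruct (proj1 (Ccvg_of_eventually B l) HB (mkposreal _ Heps)) as [J HJ]; simpl in HJ.
  set (e := fun j => Cmod (B j - l)).
  destruct (sum_truncated_bounded e J) as [E HE]; [intros j; apply Cmod_ge_0 | ].
  assert (HmE : is_lim_seq (fun N => m N * E)%R 0%R).
  { replace (Finite 0) with (Rbar_mult 0%R E) by (simpl; f_equal; ring).
    now apply is_lim_seq_scal_r. }
  apply is_lim_seq_spec in HmE.
  destruct (HmE (mkposreal _ Heps)) as [N0 HN0]; simpl in HN0.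
  exists N0; intros N HN; specialize (HN0 N HN).
  rewrite Rminus_0_r in HN0; apply Rabs_def2 in HN0.
  assert (Hsum' : sum_f_R0 (w N) N = 1%R).
  { specialize (Hsum N); rewrite Csum_RtoC in Hsum; now injection Hsum. }
  replace (Csum (fun j => w N j * B j) N - l) with (Csum (fun j => w N j * (B j - l)) N).
  2: { rewrite (Csum_ext _ (fun j => w N j * B j - l * w N j)) by (intros; ring).
       rewrite Csum_minus, Csum_scal_l, Hsum; ring. }
  eapply Rle_lt_trans; [apply Cmod_Csum_le | ].
  apply Rle_lt_trans with (sum_f_R0 (fun j =>
      (if (j <? J)%nat then e j else 0) * m N + w N j * (eps / 2))%R N).
  - apply sum_Rle; intros j _; rewrite Cmod_mult, Cmod_R, Rabs_pos_eq by apply Hw.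
    fold (e j); pose proof (Hw N j); pose proof (Cmod_ge_0 (B j - l)) as He; fold (e j) in He.
    destruct (j <? J)%nat eqn:Hj.
    + nra.
    + apply Nat.ltb_ge in Hj; specialize (HJ j Hj); fold (e j) in HJ; nra.
  - rewrite plus_sum, <- !scal_sum, Hsum'.
    (* The bounds on [w N O] give [0 <= m N], so [HEN] may be multiplied by [m N]. *)
    pose proof (HE N) as HEN; pose proof (Hw N O); nra.
Qed.

(** * Decay of the weights *)

Lemma inv_fact2_le (N j : nat) : (inv_fact2 N j <= inv_fact2 N 0)%R.
Proof.
  induction j as [ | j IH]; [lra | ].
  destruct (Nat.le_gt_cases N j) as [H | H].
  - rewrite (inv_fact2_gt N (S j)) by lia; apply inv_fact2_ge0.
  - pose proof (inv_fact2_succ_r N j) as E; pose proof (inv_fact2_ge0 N j).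
    pose proof (inv_fact2_ge0 N (S j)).
    apply lt_INR in H; pose proof (pos_INR j); nra.
Qed.

Lemma weight_le (N j : nat) : (weight N j <= weight N 0)%R.
Proof.
  unfold weight; pose proof (pos_INR j); pose proof (pos_INR N).
  pose proof (inv_fact2_le N j); pose proof (inv_fact2_ge0 N j).
  apply Rmult_le_compat.
  - repeat apply Rmult_le_pos; auto using pos_INR, Rlt_le, poch32_pos.
  - apply Rlt_le, Rinv_0_lt_compat; lra.
  - apply Rmult_le_compat_l; [ | assumption].
    apply Rmult_le_pos; auto using pos_INR, Rlt_le, poch32_pos.
  - apply Rinv_le_contravar; simpl; lra.
Qed.

Lemma weight_0_succ (N : nat) :
  weight (S N) 0 = (weight N 0 * (INR N + 3 / 2) / (INR N + 2))%R.
Proof.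
  unfold weight; rewrite <- (inv_fact2_succ_l N 0).
  pose proof (pos_INR N).
  rewrite fact_simpl, mult_INR, !S_INR; simpl; field; lra.
Qed.

(** [weight N 0 = (3/2)_N / (2)_N] decays like [N^(-1/2)]; squaring keeps the bound rational. The
    induction rests on [((N + 3/2) / (N + 2))^2 <= (N + 2) / (N + 3)], and the bound is an equality
    at [N = 0]. *)
Lemma weight_0_sq (N : nat) : (weight N 0 ^ 2 <= 2 / (INR N + 2))%R.
Proof.
  induction N as [ | N IH].
  - unfold weight, inv_fact2; simpl; lra.
  - rewrite weight_0_succ, S_INR; pose proof (pos_INR N).
    replace ((weight N 0 * (INR N + 3 / 2) / (INR N + 2)) ^ 2)%R
      with (weight N 0 ^ 2 * ((INR N + 3 / 2) / (INR N + 2)) ^ 2)%R by (field; lra).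
    apply Rle_trans with (2 / (INR N + 2) * ((INR N + 3 / 2) / (INR N + 2)) ^ 2)%R.
    + apply Rmult_le_compat_r; [apply pow2_ge_0 | exact IH].
    + apply Rminus_le_0.
      replace (2 / (INR N + 1 + 2) - 2 / (INR N + 2) * ((INR N + 3 / 2) / (INR N + 2)) ^ 2)%R
        with (2 * (3 / 4 * INR N + 5 / 4) / ((INR N + 3) * (INR N + 2) ^ 3))%R
        by (field; lra).
      apply Rmult_le_pos; [lra | apply Rlt_le, Rinv_0_lt_compat].
      apply Rmult_lt_0_compat; [lra | apply pow_lt; lra].
Qed.

Lemma is_lim_seq_inv_INR (c : R) : (0 < c)%R ->
  is_lim_seq (fun n => / (INR n + c))%R 0%R.
Proof.
  intros Hc; replace (Finite 0) with (Rbar_inv p_infty) by reflexivity.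
  apply is_lim_seq_inv; [ | discriminate].
  apply is_lim_seq_plus with p_infty c; [apply is_lim_seq_INR | apply is_lim_seq_const | reflexivity].
Qed.

Lemma is_lim_weight_0 : is_lim_seq (fun N => weight N 0) 0%R.
Proof.
  apply (is_lim_seq_le_le (fun _ => 0%R) _ (fun N => sqrt (2 / (INR N + 2)))).
  - intros N; split; [apply weight_ge0 | ].
    rewrite <- (sqrt_pow2 (weight N 0)) by apply weight_ge0.
    apply sqrt_le_1_alt, weight_0_sq.
  - apply is_lim_seq_const.
  - rewrite <- sqrt_0; apply (is_lim_seq_continuous sqrt (fun N => 2 / (INR N + 2))%R).
    + apply continuity_pt_sqrt; lra.
    + replace (Finite 0) with (Rbar_mult 2%R 0%R) by (simpl; f_equal; ring).
      apply is_lim_seq_scal_l, is_lim_seq_inv_INR; lra.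
Qed.

(** * Convergence of the digamma series *)

Lemma Cmod_add_INR_ge (s : C) (n : nat) : (2 * Cmod s <= INR n)%R ->
  ((INR n + 2) / 2 <= Cmod (s + INR (S n)))%R.
Proof.
  intros H.
  pose proof (Cmod_triangle (s + INR (S n)) (- s)) as T.
  replace (s + INR (S n) + - s) with (RtoC (INR (S n))) in T by ring.
  rewrite Cmod_opp, Cmod_R, Rabs_pos_eq, S_INR in T by apply pos_INR.
  rewrite S_INR in *; lra.
Qed.

Lemma INR_unbounded (r : R) : exists N, forall n, (N <= n)%nat -> (r <= INR n)%R.
Proof.
  destruct (nfloor_ex (Rmax 0 r)) as [N [_ HN]]; [apply Rmax_l | ].
  exists (S N); intros n Hn; apply le_INR in Hn; rewrite S_INR in Hn.
  pose proof (Rmax_r 0 r); lra.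
Qed.

Lemma Ccvg_inv_add_INR (s : C) : Ccvg (fun n => 1 / (s + INR (S n))) 0.
Proof.
  destruct (INR_unbounded (2 * Cmod s)) as [N0 HN0].
  apply is_lim_seq_incr_n with N0.
  apply (is_lim_seq_le_le (fun _ => 0%R) _ (fun n => 2 * / (INR n + 2))%R);
    [ | apply is_lim_seq_const | ].
  - intros n; split; [apply Cmod_ge_0 | ].
    pose proof (Cmod_add_INR_ge s (n + N0) (HN0 (n + N0)%nat ltac:(lia))) as H.
    pose proof (pos_INR n); rewrite plus_INR in H; pose proof (pos_INR N0).
    assert (Hz : s + INR (S (n + N0)) <> 0).
    { intros E; rewrite E, Cmod_0 in H; lra. }
    replace (1 / (s + INR (S (n + N0))) - 0) with (/ (s + INR (S (n + N0)))) by (field; exact Hz).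
    rewrite Cmod_inv by exact Hz.
    apply Rle_trans with (/ ((INR n + 2) / 2))%R.
    + apply Rinv_le_contravar; lra.
    + right; field; lra.
  - replace (Finite 0) with (Rbar_mult 2%R 0%R) by (simpl; f_equal; ring).
    apply is_lim_seq_scal_l, is_lim_seq_inv_INR; lra.
Qed.

Lemma ex_series_inv_consecutive :
  ex_series (fun n => / ((INR n + 1) * (INR n + 2)))%R.
Proof.
  exists 1%R.
  change (is_lim_seq (sum_n (fun n => / ((INR n + 1) * (INR n + 2)))%R) 1%R).
  apply (is_lim_seq_ext (fun n => 1 - / (INR n + 2))%R).
  - induction n as [ | n IH].
    + rewrite sum_O; simpl; lra.
    + rewrite sum_Sn, <- IH; change plus with Rplus.
      pose proof (pos_INR n); rewrite S_INR; field; lra.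
  - replace (Finite 1) with (Finite (1 - 0)) by (f_equal; ring).
    apply is_lim_seq_minus'; [apply is_lim_seq_const | apply is_lim_seq_inv_INR; lra].
Qed.

Definition digamma_term (s : C) (n : nat) : C := 1 / INR (S n) - 1 / (s + INR (S n)).

(** Over a common denominator the term is [s / ((n+1)(s+n+1))]. Once [n >= 2|s|], it is bounded by a
    multiple of the telescoping [1 / ((n+1)(n+2))]. *)
Lemma ex_series_Cmod_digamma_term (s : C) : ex_series (fun n => Cmod (digamma_term s n)).
Proof.
  destruct (INR_unbounded (2 * Cmod s)) as [N0 HN0].
  apply (ex_series_incr_n _ N0).
  apply (ex_series_le (V := R_CompleteNormedModule) _
    (fun k => 2 * Cmod s * / ((INR (N0 + k) + 1) * (INR (N0 + k) + 2)))%R).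
  - intros k; change norm with Rabs; rewrite Rabs_pos_eq by apply Cmod_ge_0.
    set (n := (N0 + k)%nat); unfold digamma_term.
    pose proof (Cmod_add_INR_ge s n (HN0 n ltac:(lia))) as H.
    pose proof (pos_INR n).
    assert (Hz : s + INR (S n) <> 0).
    { intros E; rewrite E, Cmod_0 in H; lra. }
    assert (Hn : RtoC (INR (S n)) <> 0) by (apply RtoC_neq_0; rewrite S_INR; lra).
    replace (1 / INR (S n) - 1 / (s + INR (S n))) with (s * / (INR (S n) * (s + INR (S n))))
      by (field; split; assumption).
    rewrite Cmod_mult, Cmod_inv, Cmod_mult, Cmod_R, Rabs_pos_eq, S_INR
      by (apply Cmult_neq_0 || apply pos_INR; assumption).
    rewrite S_INR in H.
    rewrite (Rmult_comm 2), Rmult_assoc; apply Rmult_le_compat_l; [apply Cmod_ge_0 | ].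
    apply Rle_trans with (/ ((INR n + 1) * ((INR n + 2) / 2)))%R.
    + apply Rinv_le_contravar; nra.
    + right; field; lra.
  - apply (ex_series_scal_l (V := R_NormedModule) (2 * Cmod s)%R).
    apply (ex_series_incr_n (V := R_NormedModule) (fun n => / ((INR n + 1) * (INR n + 2)))%R N0), ex_series_inv_consecutive.
Qed.

Lemma Cmod_le_Rabs (z : C) : (Cmod z <= Rabs (Re z) + Rabs (Im z))%R.
Proof.
  replace z with (RtoC (Re z) + Ci * RtoC (Im z)) at 1.
  - eapply Rle_trans; [apply Cmod_triangle | ].
    rewrite Cmod_mult, !Cmod_R, Cmod_Ci; lra.
  - destruct z as [a b]; unfold Ci, RtoC, Cmult, Cplus; simpl; f_equal; ring.
Qed.

Lemma Ccvg_CSeries (f : nat -> C) :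
  ex_series (fun n => Cmod (f n)) -> Ccvg (Csum f) (CSeries f).
Proof.
  intros H.
  assert (HRe : ex_series (fun n => Re (f n))).
  { apply (ex_series_le (V := R_CompleteNormedModule) _ _) with (2 := H).
    intros n; eapply Rle_trans; [apply Rmax_l | apply (Rmax_Cmod (f n))]. }
  assert (HIm : ex_series (fun n => Im (f n))).
  { apply (ex_series_le (V := R_CompleteNormedModule) _ _) with (2 := H).
    intros n; eapply Rle_trans; [apply Rmax_r | apply (Rmax_Cmod (f n))]. }
  apply Series_correct in HRe; apply Series_correct in HIm.
  assert (ERe : forall n, sum_n (fun n => Re (f n)) n = Re (Csum f n)).
  { induction n as [ | n IH]; [now rewrite sum_O, Csum_O | ].
    now rewrite sum_Sn, Csum_S, IH. }
  assert (EIm : forall n, sum_n (fun n => Im (f n)) n = Im (Csum f n)).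
  { induction n as [ | n IH]; [now rewrite sum_O, Csum_O | ].
    now rewrite sum_Sn, Csum_S, IH. }
  apply (Ccvg_le _ _ (fun n => Rabs (Re (Csum f n) - Series (fun n => Re (f n)))
                              + Rabs (Im (Csum f n) - Series (fun n => Im (f n))))%R).
  - intros n; apply (Cmod_le_Rabs (Csum f n - CSeries f)).
  - replace (Finite 0) with (Finite (0 + 0)) by (f_equal; ring).
    apply is_lim_seq_plus'; apply is_lim_seq_Rabs_minus.
    + exact (is_lim_seq_ext _ _ (Finite (Series (fun n => Re (f n)))) ERe HRe).
    + exact (is_lim_seq_ext _ _ (Finite (Series (fun n => Im (f n)))) EIm HIm).
Qed.

(** The harmonic number [H_(n+1)], with the index shift of [Euler_gamma]. *)
Definition harmonic (n : nat) : R := sum_f_R0 (fun k => / INR (S k))%R n.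

Definition shifted_harmonic (s : C) (n : nat) : C := Csum (fun k => 1 / (s + INR k)) n.

(** The isolated [1 / s] is the term [k = 0] of the shifted sum, which therefore runs to [S N]. *)
Lemma digamma_partial_sum (s : C) (N : nat) :
  - Euler_gamma - 1 / s + Csum (digamma_term s) N
  = - Euler_gamma + harmonic N - shifted_harmonic s (S N).
Proof.
  unfold shifted_harmonic, harmonic, digamma_term.
  induction N as [ | N IH].
  - rewrite Csum_S, !Csum_O; simpl.
    rewrite Cplus_0_r; rewrite Rinv_1; unfold Cdiv; rewrite Cinv_r; [ring | ].
    apply RtoC_neq_0; lra.
  - rewrite !Csum_S in *; rewrite Cplus_assoc, IH.
    rewrite tech5, RtoC_plus, RtoC_inv by (apply not_0_INR; lia).
    unfold Cdiv; ring.
Qed.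

Lemma Ccvg_digamma (s : C) :
  Ccvg (fun N => - Euler_gamma + harmonic N - shifted_harmonic s (S N)) (digamma s).
Proof.
  apply (Ccvg_ext (fun N => - Euler_gamma - 1 / s + Csum (digamma_term s) N));
    [apply digamma_partial_sum | ].
  apply Ccvg_plus; [apply Ccvg_const | apply Ccvg_CSeries, ex_series_Cmod_digamma_term].
Qed.

(** * Even partial sums of the alternating series *)

Lemma alt_sum_S (x : C) (k : nat) :
  alt_sum x (S k)
  = alt_sum x k + RtoC (-1) ^ k * (4 * (INR k + 1)) / ((INR k + 1) ^ 2 - x ^ 2).
Proof. reflexivity. Qed.

Lemma Cpow_opp1_even (n : nat) : RtoC (-1) ^ (2 * n) = 1.
Proof.
  rewrite Cpow_mult_r; replace (RtoC (-1) ^ 2) with (RtoC 1) by ring.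
  apply Cpow_1_l.
Qed.

(** Each term is [2 (-1)^(k-1) (1/(k-x) + 1/(k+x))], and an alternating sum is the full sum minus
    twice its even part. For [k = 2m], halving the denominators turns the even part into sums
    shifted by [x / 2]. [Hstep] checks this on the pair [k = 2M+1], [2M+2]. *)
Lemma alt_sum_even (x : C) (N : nat) : not_nonzero_int x ->
  alt_sum x (2 * N + 2)
  = 2 * (shifted_harmonic (1 - x) (2 * N + 1) + shifted_harmonic (1 + x) (2 * N + 1))
    - 2 * (shifted_harmonic (1 - x / 2) N + shifted_harmonic (1 + x / 2) N).
Proof.
  intros hx.
  assert (H2 : RtoC 2 <> 0) by (apply RtoC_neq_0; lra).
  assert (Hstep : forall M : nat,
    RtoC (-1) ^ (2 * M) * (4 * (INR (2 * M) + 1)) / ((INR (2 * M) + 1) ^ 2 - x ^ 2)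
    + RtoC (-1) ^ S (2 * M) * (4 * (INR (S (2 * M)) + 1)) / ((INR (S (2 * M)) + 1) ^ 2 - x ^ 2)
    = 2 * (1 / (1 - x + INR (2 * M)) + 1 / (1 - x + INR (S (2 * M)))
           + (1 / (1 + x + INR (2 * M)) + 1 / (1 + x + INR (S (2 * M)))))
      - 2 * (1 / (1 - x / 2 + INR M) + 1 / (1 + x / 2 + INR M))).
  { intros M.
    rewrite (Cpow_S (RtoC (-1))), Cpow_opp1_even, !Cmult_1_l.
    pose proof (not_nonzero_int_add x (2 * M) hx) as P1; pose proof (not_nonzero_int_sub x (2 * M) hx) as M1.
    pose proof (not_nonzero_int_add x (S (2 * M)) hx) as P2; pose proof (not_nonzero_int_sub x (S (2 * M)) hx) as M2.
    rewrite !RtoC_INR_S in *; rewrite !mult_INR in *; change (INR 2) with 2%R in *.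
    rewrite !RtoC_mult in *.
    set (m := RtoC (INR M)) in *.
    (* All denominators are written through the four factors known to be nonzero from [P1], [M1],
       [P2] and [M2], so that [field] leaves only these as side conditions. *)
    replace (1 / (1 - x + (2 * m))) with (1 / (2 * m + 1 - x)) by (f_equal; ring).
    replace (1 / (1 - x + (2 * m + 1))) with (1 / (2 * m + 1 + 1 - x)) by (f_equal; ring).
    replace (1 / (1 + x + (2 * m))) with (1 / (2 * m + 1 + x)) by (f_equal; ring).
    replace (1 / (1 + x + (2 * m + 1))) with (1 / (2 * m + 1 + 1 + x)) by (f_equal; ring).
    replace (1 - x / 2 + m) with ((2 * m + 1 + 1 - x) / 2) by (field; exact H2).
    replace (1 + x / 2 + m) with ((2 * m + 1 + 1 + x) / 2) by (field; exact H2).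
    replace ((2 * m + 1) ^ 2 - x ^ 2)
      with ((2 * m + 1 + x) * (2 * m + 1 - x)) by ring.
    replace ((2 * m + 1 + 1) ^ 2 - x ^ 2)
      with ((2 * m + 1 + 1 + x) * (2 * m + 1 + 1 - x)) by ring.
    field; repeat split; assumption. }
  unfold shifted_harmonic; induction N as [ | N IH].
  - change (2 * 0 + 2)%nat with (S (S (2 * 0))); change (2 * 0 + 1)%nat with (S (2 * 0)).
    rewrite !alt_sum_S, !Csum_S, <- Cplus_assoc, Hstep.
    change (2 * 0)%nat with O; rewrite !Csum_O; simpl alt_sum; ring.
  - replace (2 * S N + 2)%nat with (S (S (2 * N + 2))) by lia.
    replace (2 * S N + 1)%nat with (S (S (2 * N + 1))) by lia.
    pose proof (Hstep (S N)) as E.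
    replace (2 * S N)%nat with (2 * N + 2)%nat in E by lia.
    rewrite !alt_sum_S, <- Cplus_assoc, E, IH, !Csum_S.
    replace (S (2 * N + 1)) with (2 * N + 2)%nat by lia; ring.
Qed.

(** * The limit of harmonic differences *)

Lemma ln_le_minus_1 (t : R) : (0 < t)%R -> (ln t <= t - 1)%R.
Proof.
  intros Ht; pose proof (exp_ineq1_le (ln t)) as H.
  rewrite exp_ln in H by exact Ht; lra.
Qed.

Lemma ln_succ_bounds (a : R) : (0 < a)%R -> (/ (a + 1) <= ln (a + 1) - ln a <= / a)%R.
Proof.
  intros Ha; split.
  - rewrite <- (Ropp_involutive (_ - _)), Ropp_minus_distr, <- ln_div by lra.
    pose proof (ln_le_minus_1 (a / (a + 1))) as H.
    replace (a / (a + 1) - 1)%R with (- / (a + 1))%R in H by (field; lra).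
    assert (0 < a / (a + 1))%R by (apply Rdiv_lt_0_compat; lra); lra.
  - rewrite <- ln_div by lra.
    pose proof (ln_le_minus_1 ((a + 1) / a)) as H.
    replace ((a + 1) / a - 1)%R with (/ a)%R in H by (field; lra).
    apply H, Rdiv_lt_0_compat; lra.
Qed.

(** Logarithmic comparison term by term: the new term [1 / (N+m+2)] is bounded by [ln_succ_bounds]
    at [N+m+1] from above and at [N+m+2] from below. *)
Lemma harmonic_diff_bounds (N m : nat) :
  (ln (INR N + INR m + 2) - ln (INR N + 2) <= harmonic (N + m) - harmonic N
   <= ln (INR N + INR m + 1) - ln (INR N + 1))%R.
Proof.
  induction m as [ | m IH].
  - rewrite Nat.add_0_r; simpl; rewrite !Rplus_0_r; lra.
  - rewrite Nat.add_succ_r; unfold harmonic in *; rewrite tech5.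
    rewrite !S_INR, plus_INR; pose proof (pos_INR m); pose proof (pos_INR N).
    pose proof (ln_succ_bounds (INR N + INR m + 1) ltac:(lra)) as H1.
    pose proof (ln_succ_bounds (INR N + INR m + 2) ltac:(lra)) as H2.
    replace (INR N + (INR m + 1) + 2)%R with (INR N + INR m + 2 + 1)%R by ring.
    replace (INR N + (INR m + 1) + 1)%R with (INR N + INR m + 1 + 1)%R by ring.
    replace (INR N + INR m + 1 + 1)%R with (INR N + INR m + 2)%R in * by ring.
    lra.
Qed.

Lemma is_lim_harmonic_diff :
  is_lim_seq (fun N => harmonic (2 * N + 2) - harmonic N)%R (ln 2).
Proof.
  apply (is_lim_seq_le_le (fun _ => ln 2) _ (fun N => ln 2 + / 2 * / (INR N + 1))%R).
  (* With [m = N + 2] the lower bound is exactly [ln 2], since [(2N+4) / (N+2) = 2]; the upper one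
     is the logarithm of [(2N+3) / (N+1)]. *)
  - intros N; pose proof (harmonic_diff_bounds N (N + 2)) as H.
    replace (N + (N + 2))%nat with (2 * N + 2)%nat in H by lia.
    rewrite plus_INR in H; simpl (INR 2) in H; pose proof (pos_INR N).
    rewrite <- !ln_div in H by lra.
    replace ((INR N + (INR N + (1 + 1)) + 2) / (INR N + 2))%R with 2%R in H by (field; lra).
    replace ((INR N + (INR N + (1 + 1)) + 1) / (INR N + 1))%R
      with (2 * (1 + / 2 * / (INR N + 1)))%R in H by (field; lra).
    assert (Hp : (0 < / (INR N + 1))%R) by (apply Rinv_0_lt_compat; lra).
    rewrite ln_mult in H by lra.
    pose proof (ln_le_minus_1 (1 + / 2 * / (INR N + 1)) ltac:(lra)); lra.
  - apply is_lim_seq_const.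
  - replace (Finite (ln 2)) with (Finite (ln 2 + / 2 * 0)) by (f_equal; ring).
    apply is_lim_seq_plus'; [apply is_lim_seq_const | ].
    apply (is_lim_seq_scal_l _ (/ 2)%R 0%R), is_lim_seq_inv_INR; lra.
Qed.

(** * The limit of the alternating series and the conclusion *)

Lemma Ccvg_subseq (u : nat -> C) (l : C) (phi : nat -> nat) :
  (forall n, (n <= phi n)%nat) -> Ccvg u l -> Ccvg (fun n => u (phi n)) l.
Proof.
  intros Hphi; rewrite !Ccvg_of_eventually; intros H eps.
  destruct (H eps) as [N HN]; exists N; intros n Hn; apply HN.
  specialize (Hphi n); lia.
Qed.

Lemma Ccvg_of_even (u : nat -> C) (l : C) :
  Ccvg (fun n => u (2 * n)%nat) l -> Ccvg (fun n => u (S (2 * n)) - u (2 * n)%nat) 0 ->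
  Ccvg u l.
Proof.
  intros H0 Hd.
  assert (H1 : Ccvg (fun n => u (S (2 * n))) l).
  { replace l with (l + 0) by ring.
    apply (Ccvg_ext (fun n => u (2 * n)%nat + (u (S (2 * n)) - u (2 * n)%nat)));
      [intros n; ring | now apply Ccvg_plus]. }
  rewrite Ccvg_of_eventually in *; intros eps.
  destruct (H0 eps) as [N0 HN0]; destruct (H1 eps) as [N1 HN1].
  exists (2 * (N0 + N1) + 1)%nat; intros n Hn.
  destruct (Nat.Even_or_Odd n) as [[k ->] | [k ->]].
  - apply HN0; lia.
  - rewrite Nat.add_1_r; apply HN1; lia.
Qed.

(** The claimed value of the hypergeometric series with its factor [1 - x^2] removed. *)
Definition alt_limit (x : C) : C :=
  4 * RtoC (ln 2)
  + 2 * (digamma (1 - x / 2) + digamma (1 + x / 2))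
  - 2 * (digamma (1 - x) + digamma (1 + x)).

Lemma Ccvg_alt_sum_even (x : C) : not_nonzero_int x ->
  Ccvg (fun N => alt_sum x (2 * N + 4)) (alt_limit x).
Proof.
  intros hx.
  set (d := fun s N => - Euler_gamma + harmonic N - shifted_harmonic s (S N)).
  assert (Hd : forall s, Ccvg (d s) (digamma s)) by exact Ccvg_digamma.
  assert (Hd2 : forall s, Ccvg (fun N => d s (2 * N + 2)%nat) (digamma s)).
  { intros s; apply (Ccvg_subseq (d s)); [intros n; lia | apply Hd]. }
  (* The constants [Euler_gamma] cancel between the four digamma approximations. Their harmonic
     parts do not: they leave [4 (harmonic N - harmonic (2N+2))], which the first summand
     compensates and which produces [4 ln 2]. *)
  apply (Ccvg_ext (fun N => 4 * RtoC (harmonic (2 * N + 2) - harmonic N)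
     + 2 * (d (1 - x / 2) N + d (1 + x / 2) N)
     - 2 * (d (1 - x) (2 * N + 2)%nat + d (1 + x) (2 * N + 2)%nat))).
  - intros N; replace (2 * N + 4)%nat with (2 * S N + 2)%nat by lia.
    rewrite alt_sum_even by exact hx.
    replace (2 * S N + 1)%nat with (S (2 * N + 2)) by lia.
    unfold d; rewrite RtoC_minus; ring.
  - unfold alt_limit; apply Ccvg_minus; [apply Ccvg_plus | ];
      apply Ccvg_scal; try (apply Ccvg_plus; auto).
    apply Ccvg_RtoC, is_lim_harmonic_diff.
Qed.

Lemma Ccvg_alt_sum (x : C) : not_nonzero_int x -> Ccvg (alt_sum x) (alt_limit x).
Proof.
  intros hx; apply Ccvg_of_even.
  - apply is_lim_seq_incr_n with 2%nat.
    apply (Ccvg_ext (fun N => alt_sum x (2 * N + 4))); [ | now apply Ccvg_alt_sum_even].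
    intros N; f_equal; lia.
  (* The gap between neighbouring partial sums is the single term with [k = 2N+1], whose two simple
     fractions tend to 0. *)
  - apply (Ccvg_ext (fun N => 2 * (1 / (- x + INR (S (2 * N))) + 1 / (x + INR (S (2 * N)))))).
    + intros N; rewrite alt_sum_S, Cpow_opp1_even.
      set (k := (2 * N)%nat).
      pose proof (not_nonzero_int_add x k hx) as P; pose proof (not_nonzero_int_sub x k hx) as M.
      replace (RtoC (INR (S k))) with (INR k + 1) by (now rewrite RtoC_INR_S).
      replace (- x + (INR k + 1)) with (INR k + 1 - x) by ring.
      replace (x + (INR k + 1)) with (INR k + 1 + x) by ring.
      replace ((INR k + 1) ^ 2 - x ^ 2) with ((INR k + 1 + x) * (INR k + 1 - x)) by ring.
      field; split; assumption.
    + replace (RtoC 0) with (2 * (RtoC 0 + 0)) by ring.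
      apply Ccvg_scal, Ccvg_plus.
      * apply (Ccvg_subseq (fun n => 1 / (- x + INR (S n))) 0 (fun N => 2 * N)%nat);
          [intros; lia | apply Ccvg_inv_add_INR].
      * apply (Ccvg_subseq (fun n => 1 / (x + INR (S n))) 0 (fun N => 2 * N)%nat);
          [intros; lia | apply Ccvg_inv_add_INR].
Qed.

Theorem theorem2p1 (x : C) (hx : forall k : Z, k <> 0%Z -> x <> RtoC (IZR k)) :
  is_hypergeom [RtoC 1; RtoC 1; 3 / 2] [2 - x; 2 + x] 1
    (4 * RtoC (ln 2) * (1 - x ^ 2)
     + 2 * (1 - x ^ 2) * (digamma (1 - x / 2) + digamma (1 + x / 2))
     - 2 * (1 - x ^ 2) * (digamma (1 - x) + digamma (1 + x))).
Proof.
  apply is_series_Ccvg.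
  match goal with |- Ccvg _ ?l =>
    replace l with ((1 - x ^ 2) * alt_limit x) by (unfold alt_limit; ring) end.
  apply (Ccvg_ext (fun N => (1 - x ^ 2) *
    Csum (fun j => weight (S N) j * alt_sum x j) (S N))).
  - intros N; rewrite <- partial_sum_as_mean, <- Csum_scal_l by exact hx.
    apply Csum_ext; intros n; symmetry; now apply hypergeom_term_eq.
  - apply Ccvg_scal.
    (* The means occur at index [N + 1], hence the shifted sequence. *)
    apply (Ccvg_subseq (fun N => Csum (fun j => weight N j * alt_sum x j) N) _ S);
      [intros n; lia | ].
    apply Ccvg_regular_mean with (fun N => weight N 0).
    + intros N j; split; [apply weight_ge0 | apply weight_le].
    + apply sum_weight.
    + apply is_lim_weight_0.
    + now apply Ccvg_alt_sum.
Qed.
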